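(* Let $(a_k)_{k\ge1}$ be an infinite sequence of positive integers with $a_1=1$ and $a_{k+1}\ge a_k$ for all $k\in\mathbb{N}=\{1,2,\dots\}$, let $G=\mathcal{AT}((a_k))$ be the corresponding infinite antitree with generations $V_k$, and let $x,y$ be neighbouring vertices in $G$. Then the $p$-Ollivier-Ricci curvature, $p\in[0,1]$, is given as follows. (Radial root edges) If $x\in V_1$ and $y\in V_2$: $$\kappa_p(x,y)=\begin{cases}\dfrac{a_2-1}{a_2+a_3}+\dfrac{a_2+2a_3+1}{a_2+a_3}\,p, & \text{if } p\in\left[0,\frac1{a_2+a_3+1}\right],\\[2mm] \dfrac{a_2+1}{a_2+a_3}(1-p), & \text{if } p\in\left[\frac1{a_2+a_3+1},1\right].\end{cases}$$ (Radial edges) If $x\in V_k$ and $y\in V_{k+1}$ with $k\ge2$, then for all $p\in[0,1]$: $$\kappa_p(x,y)=\left(\frac{2a_k+a_{k+1}-1}{a_k+a_{k+1}+a_{k+2}-1}-\frac{2a_{k-1}+a_k-1}{a_{k-1}+a_k+a_{k+1}-1}\right)(1-p).$$ (Spherical edges) If $x,y\in V_k$, $x\ne y$, $k\ge2$: $$\kappa_p(x,y)=\begin{cases}\dfrac{a_{k-1}+a_k+a_{k+1}-2}{a_{k-1}+a_k+a_{k+1}-1}+\dfrac{a_{k-1}+a_k+a_{k+1}}{a_{k-1}+a_k+a_{k+1}-1}\,p, & \text{if } p\in\left[0,\frac1{a_{k-1}+a_k+a_{k+1}}\right],\\[2mm] \dfrac{a_{k-1}+a_k+a_{k+1}}{a_{k-1}+a_k+a_{k+1}-1}(1-p),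 & \text{if } p\in\left[\frac1{a_{k-1}+a_k+a_{k+1}},1\right].\end{cases}$$
   Context: Antitree: for a sequence $(a_k)_{k\ge1}$ of positive integers, $\mathcal{AT}((a_k))$ is the simple graph whose vertex set is the disjoint union $V=\bigsqcup_{k\ge1}V_k$ of ''generations'' with $|V_k|=a_k$, where two distinct vertices $x\in V_k$, $y\in V_l$ are adjacent if and only if $|k-l|\le 1$ (so each generation induces a complete graph, consecutive generations are completely joined, and there are no other edges). Ollivier-Ricci curvature: let $d$ be the combinatorial distance and $d_x$ the degree of $x$. For $x\in V$ and $p\in[0,1]$ let $\mu_x^p$ be the probability measure on $V$ with $\mu_x^p(x)=p$, $\mu_x^p(z)=\frac{1-p}{d_x}$ for $z\sim x$, and $\mu_x^p(z)=0$ otherwise. The Wasserstein distance of two probability measures $\mu_1,\mu_2$ on $V$ is $W_1(\mu_1,\mu_2)=\inf_\pi\sum_{x,y\in V}d(x,y)\pi(x,y)$, the infimum running over all $\pi:V\times V\to[0,1]$ with $\mu_1(x)=\sum_y\pi(x,y)$ and $\mu_2(y)=\sum_x\pi(x,y)$. For an edge $x\sim y$, $\kappa_p(x,y)=1-W_1(\mu_x^p,\mu_y^p)$. *)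

(* Defs.v *)
From HB Require Import structures.
From mathcomp Require Import all_boot all_order all_algebra finmap.
From mathcomp Require Import all_classical all_reals all_analysis.

Set Implicit Arguments.
Unset Strict Implicit.
Unset Printing Implicit Defensive.

Import Order.TTheory GRing.Theory Num.Theory.
Local Open Scope classical_set_scope.
Local Open Scope ring_scope.

(* Ollivier-Ricci curvature of a locally finite simple graph, given by a vertex
   type V and a symmetric irreflexive adjacency relation e. *)

(* Least number of edges of a walk from x to y; it is +oo when no walk exists. *)
Definition graph_dist (R : realType) (V : choiceType) (e : rel V) (x y : V)
  : \bar R :=
  ereal_inf [set ((size s)%:R)%:E | s in [set s : seq V | path e x s /\ last x s = y]].

(* fset_set sends infinite sets to fset0, so this is the degree only at vertices
   with finitely many neighbours. *)
Definition graph_deg (V : choiceType) (e : rel V) (x : V) : nat :=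
  #|` fset_set [set z | e x z] |.

Definition lazy_walk (R : realType) (V : choiceType) (e : rel V) (p : R)
    (x : V) : V -> R :=
  fun z => if z == x then p
           else if e x z then (1 - p) / (graph_deg e x)%:R
           else 0.

Definition transport_plan (R : realType) (V : choiceType) (mu1 mu2 : V -> R)
  : set (V * V -> R) :=
  [set pi | [/\ forall u, 0 <= pi u <= 1,
                forall x, (mu1 x)%:E = \esum_(y in [set: V]) (pi (x, y))%:E
              & forall y, (mu2 y)%:E = \esum_(x in [set: V]) (pi (x, y))%:E]].

Definition wasserstein1 (R : realType) (V : choiceType) (e : rel V)
    (mu1 mu2 : V -> R) : \bar R :=
  ereal_inf [set (\esum_(u in [set: V * V])
                    (graph_dist R e u.1 u.2 * (pi u)%:E)%E)
            | pi in transport_plan mu1 mu2].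

Definition ollivier_curvature (R : realType) (V : choiceType) (e : rel V)
    (p : R) (x y : V) : \bar R :=
  (1 - wasserstein1 e (lazy_walk e p x) (lazy_walk e p y))%E.

(* The sequence (a_k) is indexed from k = 1 and the value a 0 is never used:
   the vertex with tag k lies in generation k.+1, which has a k.+1 elements. *)
Definition antitree_vertex (a : nat -> nat) : choiceType := {k : nat & 'I_(a k.+1)}.

Definition generation (a : nat -> nat) (x : antitree_vertex a) : nat := (tag x).+1.

Definition antitree_adj (a : nat -> nat) : rel (antitree_vertex a) :=
  fun x y => [&& x != y, (generation x <= (generation y).+1)%N
               & (generation y <= (generation x).+1)%N].

(* Main.v *)
Require Import Defs.
From mathcomp Require Import all_boot all_order all_algebra.
From mathcomp Require Import all_classical all_reals all_analysis.
From mathcomp Require Import ring lra zify.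

Set Implicit Arguments.
Unset Strict Implicit.
Unset Printing Implicit Defensive.

Import Order.TTheory GRing.Theory Num.Theory.
Local Open Scope ring_scope.

(** Each curvature is computed by complementary slackness for optimal transport.
    If phi is 1-Lipschitz, every plan from mu to nu costs at least
    sum phi * (nu - mu), because d(u, v) >= phi v - phi u; a plan that moves mass
    only along tight pairs, those with d(u, v) = phi v - phi u, attains this
    bound and is therefore optimal ([wasserstein1_tight_plan]). The mass that two
    measures share may stay where it is, so tight plans are mostly free: it is
    enough that every vertex with an excess of mu forms a tight pair with every
    vertex with an excess of nu ([finite_plan_excess_deficit]). Tight plans for a
    fixed phi also form a convex cone ([finite_plan_mix]), so for a family of
    measures that is affine in p it is enough to find them at the two ends of an
    interval of values of p.

    Spherical edges. The endpoints x and y have the same neighbours apart from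
    each other, so the two walks differ only at x and y, by
    |p - (1 - p) / deg x|, and that much mass crosses the edge.

    Radial edges. The potential is the generation. It is tight on all pairs
    (u, v) where v lies in a later generation than u, since consecutive
    generations are completely joined; so a plan is optimal as soon as mass
    never moves sideways or backwards. At p = 1 there is nothing to do. At p = 0
    every vertex of V_k and V_(k+1) other than x and y carries at least as much
    mass in the walk from x as in the walk from y, because the sequence is
    nondecreasing and so deg x <= deg y; the only deficits are at x, which a
    single vertex of V_(k-1) can fill, and in V_(k+2), which lies above
    everything else ([radial_plan0]).

    Root edges. Now no generation below V_1 can fill the deficit at x. It is
    present exactly when p < 1 / (deg y + 1). Above this threshold the argument
    with the generation works between the threshold and 1. Below it, mass has to
    leave V_2 both for x and for V_3, and the potential has to be replaced by
    the indicator of the complement of V_2. *)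

(** * Optimal transport by complementary slackness *)

Lemma esum_seq (R : realType) (T : choiceType) (s : seq T) (f : T -> \bar R) :
  uniq s -> (forall x, (0 <= f x)%E) -> (forall x, x \notin s -> f x = 0%E) ->
  \esum_(x in [set: T]) f x = (\sum_(x <- s) f x)%E.
Proof.
move=> s_uniq f_ge0 f_out.
rewrite fsbig_seq// -esum_fset//.
rewrite [RHS]esum_mkcond; apply: eq_esum => x _.
by case: ifPn => //; rewrite notin_setE /= => /negP /f_out.
Qed.

(** Plans are kept as finite sums: all measures in play live on a finite set [s],
    and the relation [T] records along which pairs mass is allowed to move. *)
Definition finite_plan (R : realType) (V : choiceType) (s : seq V)
    (T : V -> V -> Prop) (mu nu : V -> R) : Prop :=
  exists pi : V -> V -> R,
    [/\ forall u v, 0 <= pi u v,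
        forall u v, pi u v != 0 -> [/\ u \in s, v \in s & T u v],
        forall u, mu u = \sum_(v <- s) pi u v
      & forall v, nu v = \sum_(u <- s) pi u v].

Lemma finite_plan_mix (R : realType) (V : choiceType) (s : seq V)
    (T : V -> V -> Prop) (c1 c2 : R) (mu1 nu1 mu2 nu2 mu nu : V -> R) :
  0 <= c1 -> 0 <= c2 ->
  finite_plan s T mu1 nu1 -> finite_plan s T mu2 nu2 ->
  (forall z, mu z = c1 * mu1 z + c2 * mu2 z) ->
  (forall z, nu z = c1 * nu1 z + c2 * nu2 z) ->
  finite_plan s T mu nu.
Proof.
move=> c1_ge0 c2_ge0 [pi1 [pi1_ge0 pi1T mu1E nu1E]] [pi2 [pi2_ge0 pi2T mu2E nu2E]].
move=> muE nuE; exists (fun u v => c1 * pi1 u v + c2 * pi2 u v); split.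
- by move=> u v; rewrite addr_ge0 ?mulr_ge0.
- move=> u v; have [-> | /pi1T //] := eqVneq (pi1 u v) 0.
  have [-> | /pi2T //] := eqVneq (pi2 u v) 0.
  by rewrite !mulr0 addr0 eqxx.
- by move=> u; rewrite big_split /= -!mulr_sumr muE mu1E mu2E.
- by move=> v; rewrite big_split /= -!mulr_sumr nuE nu1E nu2E.
Qed.

(** The plan leaves min (mu, nu) in place and spreads each excess over the
    deficits in proportion to their size. Its off-diagonal support is the whole
    product of the excess set and the deficit set, which is why [T] is required
    there without exception. *)
Lemma finite_plan_excess_deficit (R : realType) (V : choiceType) (s : seq V)
    (T : V -> V -> Prop) (mu nu : V -> R) :
  uniq s -> (forall z, 0 <= mu z) -> (forall z, 0 <= nu z) ->
  (forall z, z \notin s -> mu z = 0) -> (forall z, z \notin s -> nu z = 0) ->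
  \sum_(z <- s) mu z = \sum_(z <- s) nu z ->
  (forall u, T u u) -> (forall u v, nu u < mu u -> mu v < nu v -> T u v) ->
  finite_plan s T mu nu.
Proof.
move=> s_uniq mu_ge0 nu_ge0 mu_out nu_out mass_eq Trefl T_excess.
pose common z := Num.min (mu z) (nu z).
pose excess z := mu z - common z; pose deficit z := nu z - common z.
pose m := \sum_(z <- s) excess z.
have mE : m = \sum_(z <- s) deficit z by rewrite /m !sumrB mass_eq.
have excess_ge0 z : 0 <= excess z by rewrite subr_ge0 ge_min lexx.
have deficit_ge0 z : 0 <= deficit z by rewrite subr_ge0 ge_min lexx orbT.
have m_ge0 : 0 <= m by apply: sumr_ge0.
have common_out z : z \notin s -> common z = 0.
  by move=> zs; rewrite /common mu_out// nu_out// minxx.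
have excess_out z : z \notin s -> excess z = 0.
  by move=> zs; rewrite /excess mu_out// common_out// subrr.
have deficit_out z : z \notin s -> deficit z = 0.
  by move=> zs; rewrite /deficit nu_out// common_out// subrr.
(* When m = 0 the division returns 0, in agreement with excess and deficit. *)
have cancel f z : (forall z, 0 <= f z) -> (forall z, z \notin s -> f z = 0) ->
    m = \sum_(z <- s) f z -> f z * m / m = f z.
  move=> f_ge0 f_out mf; have [m0 | m_neq0] := eqVneq m 0; last by rewrite mulfK.
  rewrite m0 mulr0 mul0r; case: (boolP (z \in s)) => [zs | /f_out //].
  move: mf; rewrite m0 => /esym/eqP; rewrite psumr_eq0// => /allP/(_ _ zs) /eqP.
  by [].
have diag_sum u : \sum_(v <- s) (if u == v then common u else 0) = common u.
  rewrite -big_mkcond /=; case: (boolP (u \in s)) => us; last first.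
    rewrite common_out// big1_seq// => v /andP[/eqP uv]; by rewrite -uv (negbTE us).
  rewrite (big_rem u us) /= eqxx big_seq_cond big1 ?addr0// => v.
  by rewrite mem_rem_uniq// inE => /andP[/andP[/eqP ? _] /eqP ?]; congruence.
exists (fun u v => (if u == v then common u else 0) + excess u * deficit v / m); split.
- move=> u v; apply: addr_ge0; last by rewrite divr_ge0// mulr_ge0.
  by case: ifP => // _; rewrite le_min mu_ge0 nu_ge0.
- move=> u v; have [-> | uv] := eqVneq u v.
    case: (boolP (v \in s)) => // vs.
    by rewrite common_out// deficit_out// mulr0 mul0r addr0 eqxx.
  rewrite add0r => pi_neq0.
  have exu : excess u != 0 by apply: contraNneq pi_neq0 => ->; rewrite !mul0r.
  have dev : deficit v != 0 by apply: contraNneq pi_neq0 => ->; rewrite mulr0 mul0r.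
  split.
  + by apply: contraNT exu => /excess_out ->.
  + by apply: contraNT dev => /deficit_out ->.
  + apply: T_excess; rewrite ltNge; [apply: contraNN exu | apply: contraNN dev].
      by move=> h; rewrite /excess /common min_l// subrr.
    by move=> h; rewrite /deficit /common min_r// subrr.
- move=> u; rewrite big_split /= diag_sum -mulr_suml -mulr_sumr -mE cancel//.
  by rewrite /excess addrC subrK.
- move=> v; rewrite big_split /=.
  under eq_bigr do rewrite eq_sym.
  rewrite [X in X + _](_ : _ = common v).
    rewrite -mulr_suml -mulr_suml -/m [m * _]mulrC cancel//.
    by rewrite /deficit addrC subrK.
  rewrite -[RHS]diag_sum; apply: eq_bigr => u _; by case: eqVneq => // ->.
Qed.

Definition dirac_mass (R : realType) (V : choiceType) (u z : V) : R := (z == u)%:R.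

Lemma sum_dirac_mass (R : realType) (V : choiceType) (s : seq V) (u : V) (F : V -> R) :
  uniq s -> u \in s -> \sum_(z <- s) F z * dirac_mass R u z = F u.
Proof.
move=> s_uniq us; rewrite (bigD1_seq u)//= /dirac_mass eqxx mulr1 big1 ?addr0//.
by move=> z /negbTE ->; rewrite mulr0.
Qed.

Lemma finite_plan_dirac (R : realType) (V : choiceType) (s : seq V)
    (T : V -> V -> Prop) (u v : V) :
  uniq s -> u \in s -> v \in s -> T u v ->
  finite_plan s T (dirac_mass R u) (dirac_mass R v).
Proof.
move=> s_uniq us vs Tuv.
exists (fun z w => dirac_mass R u z * dirac_mass R v w); split.
- by move=> z w; rewrite mulr_ge0.
- move=> z w; rewrite /dirac_mass.
  by case: (eqVneq z u) => [->|_]; case: (eqVneq w v) => [->|_]; rewrite ?mul0r ?mulr0 ?eqxx.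
- by move=> z; rewrite sum_dirac_mass.
- by move=> w; under eq_bigr do rewrite mulrC; rewrite sum_dirac_mass.
Qed.

(** A bound on edges is enough: it adds up along walks
    ([lipschitz1_graph_dist]). For a symmetric [e] the one-sided bound is
    two-sided. *)
Definition lipschitz1 (R : realType) (V : choiceType) (e : rel V)
    (phi : V -> R) : Prop :=
  forall u v, e u v -> phi v - phi u <= 1.

Lemma indicator_lipschitz (R : realType) (V : choiceType) (e : rel V) (P : pred V) :
  lipschitz1 e (fun z => (P z)%:R : R).
Proof. by move=> u v _; case: (P u); case: (P v); rewrite /=; lra. Qed.

Lemma graph_dist_ge0 (R : realType) (V : choiceType) (e : rel V) (u v : V) :
  (0 <= graph_dist R e u v)%E.
Proof. by apply: le_ereal_inf_tmp => _ [s _ <-]; rewrite lee_fin. Qed.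

Lemma lipschitz1_graph_dist (R : realType) (V : choiceType) (e : rel V)
    (phi : V -> R) (u v : V) :
  lipschitz1 e phi -> ((phi v - phi u)%:E <= graph_dist R e u v)%E.
Proof.
move=> lip; apply: le_ereal_inf_tmp => _ [s [es lasts] <-].
rewrite lee_fin -lasts {v lasts}.
elim: s u es => [|w s IHs] u /=; first by rewrite subrr.
move=> /andP[/lip uw /IHs ws]; rewrite -natr1; lra.
Qed.

Definition tight (R : realType) (V : choiceType) (e : rel V) (phi : V -> R)
    (u v : V) : Prop :=
  graph_dist R e u v = (phi v - phi u)%:E.

Lemma graph_dist_tight (R : realType) (V : choiceType) (e : rel V)
    (phi : V -> R) (u v : V) (s : seq V) :
  lipschitz1 e phi -> path e u s -> last u s = v -> (size s)%:R = phi v - phi u ->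
  tight e phi u v.
Proof.
rewrite /tight => lip es lasts sizes; apply/eqP; rewrite eq_le lipschitz1_graph_dist// andbT.
by apply: ereal_inf_lbound; exists s; rewrite ?sizes.
Qed.

Lemma tight_refl (R : realType) (V : choiceType) (e : rel V) (phi : V -> R) (u : V) :
  tight e phi u u.
Proof.
rewrite /tight subrr; apply/eqP; rewrite eq_le graph_dist_ge0 andbT.
by apply: ereal_inf_lbound; exists [::].
Qed.

Lemma tight_edge (R : realType) (V : choiceType) (e : rel V) (phi : V -> R) (u v : V) :
  lipschitz1 e phi -> e u v -> phi v - phi u = 1 -> tight e phi u v.
Proof.
by move=> lip uv phi1; apply: (graph_dist_tight (s := [:: v])) => //=; rewrite uv.
Qed.

Lemma plan_potential (R : realType) (V : choiceType) (s : seq V)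
    (phi mu nu : V -> R) (pi : V -> V -> R) :
  (forall u, mu u = \sum_(v <- s) pi u v) ->
  (forall v, nu v = \sum_(u <- s) pi u v) ->
  \sum_(u <- s) \sum_(v <- s) (phi v - phi u) * pi u v
    = \sum_(z <- s) phi z * nu z - \sum_(z <- s) phi z * mu z.
Proof.
move=> muE nuE.
under eq_bigr => u _ do (under eq_bigr => v _ do rewrite mulrBl; rewrite sumrB).
rewrite sumrB exchange_big /=; congr (_ - _); apply: eq_bigr => z _.
  by rewrite -mulr_sumr -nuE.
by rewrite -mulr_sumr -muE.
Qed.

(** Complementary slackness. Both inequalities compare the cost of a plan with
    the double sum of (phi v - phi u) * pi (u, v), which depends on the marginals
    only ([plan_potential]): it bounds the cost from below for every plan, and
    equals it for a plan with tight support. *)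
Theorem wasserstein1_tight_plan (R : realType) (V : choiceType) (e : rel V)
    (s : seq V) (phi mu nu : V -> R) :
  uniq s -> lipschitz1 e phi -> \sum_(z <- s) mu z = 1 ->
  finite_plan s (tight e phi) mu nu ->
  wasserstein1 e mu nu
    = (\sum_(z <- s) phi z * nu z - \sum_(z <- s) phi z * mu z)%:E.
Proof.
move=> s_uniq lip mass1 [pi [pi_ge0 pi_tight muE nuE]].
have pi_out u v : (u \notin s) || (v \notin s) -> pi u v = 0.
  move=> uvs; apply/eqP/negPn; apply/negP => /pi_tight[us vs _].
  by rewrite us vs in uvs.
have mu_out z : z \notin s -> mu z = 0.
  by move=> zs; rewrite muE big1// => v _; rewrite pi_out// zs.
have nu_out z : z \notin s -> nu z = 0.
  by move=> zs; rewrite nuE big1// => v _; rewrite pi_out// zs orbT.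
pose s2 := [seq (u, v) | u <- s, v <- s].
have s2_uniq : uniq s2 by apply: allpairs_uniq => // -[? ?] [? ?].
have mem_s2 u : (u \in s2) = (u.1 \in s) && (u.2 \in s).
  case: u => u v; apply/allpairsP/andP => [[[u' v'] /= [us vs [-> ->]]] // | [us vs]].
  by exists (u, v).
have costE (pi' : V * V -> R) : (forall u, 0 <= pi' u) ->
    (forall u, u \notin s2 -> pi' u = 0) ->
    (\esum_(u in [set: V * V]) (graph_dist R e u.1 u.2 * (pi' u)%:E))%E
    = (\sum_(u <- s) \sum_(v <- s) graph_dist R e u v * (pi' (u, v))%:E)%E.
  move=> pi'_ge0 pi'_out; rewrite (esum_seq s2_uniq) ?big_allpairs//.
    by move=> u; rewrite mule_ge0 ?graph_dist_ge0 ?lee_fin.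
  by move=> u /pi'_out ->; rewrite mule0.
apply/eqP; rewrite eq_le; apply/andP; split.
  apply: ereal_inf_lbound; exists (fun u => pi u.1 u.2).
    split.
    - move=> [u v] /=; rewrite pi_ge0 /=.
      case: (boolP ((u \in s) && (v \in s))) => [/andP[us vs] | ]; last first.
        by rewrite negb_and => /pi_out ->.
      rewrite -mass1 (big_rem u us) /= muE (big_rem v vs) /= -addrA lerDl.
      apply: addr_ge0; apply: sumr_ge0 => // z _; rewrite muE; exact: sumr_ge0.
    - move=> u; rewrite (esum_seq s_uniq) ?sumEFin ?muE//.
        by move=> v; rewrite lee_fin pi_ge0.
      by move=> v vs; rewrite /= pi_out ?vs ?orbT.
    - move=> v; rewrite (esum_seq s_uniq) ?sumEFin ?nuE//.
        by move=> u; rewrite lee_fin pi_ge0.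
      by move=> u us; rewrite /= pi_out ?us.
  rewrite costE//; last first.
    by move=> u; rewrite mem_s2 negb_and => /pi_out ->.
  rewrite -(plan_potential phi muE nuE) -sumEFin; apply: eq_bigr => u _.
  rewrite -sumEFin; apply: eq_bigr => v _ /=.
  have [-> | /pi_tight[_ _ ->]] := eqVneq (pi u v) 0; first by rewrite mule0 mulr0.
  by rewrite -EFinM.
apply: le_ereal_inf_tmp => _ [pi' [pi'01 mu'E nu'E] <-].
have pi'_ge0 u : 0 <= pi' u by case/andP: (pi'01 u).
have pi'_out u : u \notin s2 -> pi' u = 0.
  case: u => u v; rewrite mem_s2 negb_and /= => /orP[us | vs].
    apply/eqP; rewrite eq_le pi'_ge0 andbT -lee_fin -(mu_out _ us) mu'E.
    rewrite -[X in (X <= _)%E](@esum_set1 _ _ v (fun v => (pi' (u, v))%:E)) ?lee_fin//.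
    by rewrite esum_mkcond; apply: le_esum => w _; case: ifP; rewrite ?lee_fin.
  apply/eqP; rewrite eq_le pi'_ge0 andbT -lee_fin -(nu_out _ vs) nu'E.
  rewrite -[X in (X <= _)%E](@esum_set1 _ _ u (fun u => (pi' (u, v))%:E)) ?lee_fin//.
  by rewrite esum_mkcond; apply: le_esum => w _; case: ifP; rewrite ?lee_fin.
have mu''E u : mu u = \sum_(v <- s) pi' (u, v).
  apply: EFin_inj; rewrite mu'E (esum_seq s_uniq) ?sumEFin//.
    by move=> v; rewrite lee_fin.
  by move=> v vs; rewrite pi'_out// mem_s2 /= (negbTE vs) andbF.
have nu''E v : nu v = \sum_(u <- s) pi' (u, v).
  apply: EFin_inj; rewrite nu'E (esum_seq s_uniq) ?sumEFin//.
    by move=> u; rewrite lee_fin.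
  by move=> u us; rewrite pi'_out// mem_s2 /= (negbTE us).
rewrite costE// -(plan_potential phi (pi := fun u v => pi' (u, v)) mu''E nu''E).
rewrite -sumEFin; apply: lee_sum => u _; rewrite -sumEFin; apply: lee_sum => v _.
by rewrite EFinM lee_wpmul2r ?lee_fin// lipschitz1_graph_dist.
Qed.

(** When two measures differ only at the ends of an edge, the difference crosses
    that edge; the indicator of the receiving end is the potential. *)
Lemma wasserstein1_edge (R : realType) (V : choiceType) (e : rel V) (s : seq V)
    (mu nu : V -> R) (x y : V) :
  uniq s -> (forall z, 0 <= mu z) -> (forall z, 0 <= nu z) ->
  (forall z, z \notin s -> mu z = 0) -> (forall z, z \notin s -> nu z = 0) ->
  \sum_(z <- s) mu z = 1 -> \sum_(z <- s) nu z = 1 ->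
  y \in s -> x != y -> e x y ->
  (forall z, z != x -> z != y -> mu z = nu z) -> mu y <= nu y ->
  wasserstein1 e mu nu = (nu y - mu y)%:E.
Proof.
move=> s_uniq mu_ge0 nu_ge0 mu_out nu_out mu1 nu1 ys xNy xy agree muy.
pose phi := dirac_mass R y.
have lip : lipschitz1 e phi := @indicator_lipschitz R V e (pred1 y).
rewrite (wasserstein1_tight_plan (s := s) (phi := phi))//.
  under eq_bigr do rewrite mulrC.
  under [X in _ - X]eq_bigr do rewrite mulrC.
  by rewrite !sum_dirac_mass.
apply: finite_plan_excess_deficit => //; first by rewrite mu1 nu1.
  exact: tight_refl.
move=> u v exu dev.
have ux : u = x.
  apply/eqP; apply: contraTT exu => ux; rewrite -leNgt.
  by have [-> // | uy] := eqVneq u y; rewrite agree.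
have vy : v = y.
  apply/eqP; apply: contraTT dev => vy; rewrite -leNgt.
  by have [-> | vx] := eqVneq v x; [rewrite -ux ltW | rewrite agree].
rewrite ux vy; apply: tight_edge => //.
by rewrite /phi /dirac_mass eqxx (negbTE xNy) subr0.
Qed.

(** * Lazy walks *)

Lemma graph_degE (V : choiceType) (e : rel V) (x : V) (s : seq V) :
  uniq s -> (forall z, e x z -> z \in s) -> graph_deg e x = count (e x) s.
Proof.
move=> s_uniq nbr_s; rewrite /graph_deg -size_filter.
have nbr_seq : [set z | e x z]%classic = [set` seq.filter (e x) s]%classic.
  apply/seteqP; split=> z /=; rewrite mem_filter; last by case/andP.
  by move=> xz; rewrite xz nbr_s.
apply/perm_size/uniq_perm; rewrite ?filter_uniq ?fset_uniq// => z.
rewrite in_fset_set; first by rewrite nbr_seq; apply/idP/idP; rewrite inE.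
by rewrite nbr_seq.
Qed.

Lemma lazy_walk_ge0 (R : realType) (V : choiceType) (e : rel V) (p : R) (x z : V) :
  0 <= p <= 1 -> 0 <= lazy_walk e p x z.
Proof.
move=> /andP[p0 p1]; rewrite /lazy_walk; case: ifP => // _; case: ifP => // _.
by rewrite divr_ge0// subr_ge0.
Qed.

Lemma lazy_walk_sum (R : realType) (V : choiceType) (e : rel V) (p : R) (x : V)
    (s : seq V) (F : V -> R) :
  uniq s -> x \in s -> ~~ e x x ->
  \sum_(z <- s) F z * lazy_walk e p x z
    = p * F x + (1 - p) / (graph_deg e x)%:R * \sum_(z <- s | e x z) F z.
Proof.
move=> s_uniq xs exx; rewrite (bigD1_seq x)//= {1}/lazy_walk eqxx mulrC.
congr (_ + _); rewrite mulr_sumr [RHS]big_mkcond [LHS]big_mkcond /=.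
apply: eq_bigr => z _; rewrite /lazy_walk; case: eqVneq => /= [-> | _].
  by rewrite (negbTE exx).
by case: ifP => _; rewrite ?mulr0// mulrC.
Qed.

Lemma lazy_walk_mix (R : realType) (V : choiceType) (e : rel V) (t p q : R) (x z : V) :
  lazy_walk e (t * p + (1 - t) * q) x z
    = t * lazy_walk e p x z + (1 - t) * lazy_walk e q x z.
Proof.
rewrite /lazy_walk; case: ifP => // _; case: ifP => _; last by rewrite !mulr0 addr0.
by ring.
Qed.

Lemma lazy_walk1 (R : realType) (V : choiceType) (e : rel V) (x z : V) :
  lazy_walk e 1 x z = dirac_mass R x z.
Proof. by rewrite /lazy_walk /dirac_mass subrr mul0r; case: ifP => //; case: ifP. Qed.

(** * Counting by generations in an antitree *)

Definition first_generations (a : nat -> nat) (n : nat) : seq (antitree_vertex a) :=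
  [seq Tagged (fun k => 'I_(a k.+1)) i | k <- iota 0 n, i <- enum 'I_(a k.+1)].

Definition near_generation (k l : nat) : bool := (k <= l.+1)%N && (l <= k.+1)%N.

Section Antitree.
Variable a : nat -> nat.
Local Notation V := (antitree_vertex a).
Local Notation adj := (@antitree_adj a).

Lemma mem_first_generations n (z : V) :
  (z \in first_generations a n) = (generation z <= n)%N.
Proof.
apply/allpairsPdep/idP => [[k [i [+ _ ->]]] | ].
  by rewrite mem_iota.
case: z => k i kn; exists k, i; split=> //; first by rewrite mem_iota.
exact: mem_enum.
Qed.

Lemma first_generations_uniq n : uniq (first_generations a n).
Proof.
apply: allpairs_uniq_dep => [|k _|[k i] [l j] _ _ /= //].
  exact: iota_uniq.
exact: enum_uniq.
Qed.

(** Generations are numbered from 1, but a 0 may be nonzero and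
    near_generation 1 0 holds, so a range starting at 0 would overcount. *)
Lemma first_generations_sum (R : realType) n (P : pred nat) (F : nat -> R) :
  \sum_(z <- first_generations a n | P (generation z)) F (generation z)
    = \sum_(1 <= k < n.+1 | P k) F k * (a k)%:R.
Proof.
rewrite [LHS]big_mkcond big_allpairs_dep /= big_add1 /= [RHS]big_mkcond.
rewrite /index_iota subn0; apply: eq_bigr => k _.
rewrite (eq_bigr (fun=> if P k.+1 then F k.+1 else 0))//.
rewrite big_const_seq count_predT size_enum_ord iter_addr_0.
by case: ifP => _; rewrite ?mul0rn// mulr_natr.
Qed.

Lemma antitree_adjE (x z : V) :
  adj x z = (z != x) && near_generation (generation x) (generation z).
Proof. by rewrite /antitree_adj eq_sym. Qed.

Lemma antitree_adj_irr (x : V) : ~~ adj x x.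
Proof. by rewrite antitree_adjE eqxx. Qed.

Lemma antitree_adj_sym (x y : V) : adj x y = adj y x.
Proof. by rewrite /antitree_adj eq_sym [X in _ && X]andbC. Qed.

Lemma antitree_lazy_walkE (R : realType) (p : R) (x z : V) :
  lazy_walk adj p x z =
  if z == x then p
  else if near_generation (generation x) (generation z)
  then (1 - p) / (graph_deg adj x)%:R else 0.
Proof. by rewrite /lazy_walk antitree_adjE; case: eqP. Qed.

(** Every vertex is near itself without being its own neighbour, hence the
    correction term. *)
Lemma antitree_nbr_sum (R : realType) n (x : V) (F : nat -> R) :
  (generation x <= n)%N ->
  \sum_(z <- first_generations a n | adj x z) F (generation z)
    = \sum_(1 <= k < n.+1 | near_generation (generation x) k) F k * (a k)%:R
      - F (generation x).
Proof.
move=> xn; rewrite -first_generations_sum.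
rewrite [X in X - _]big_mkcond (bigD1_seq x) ?mem_first_generations//=; last first.
  exact: first_generations_uniq.
rewrite {1}/near_generation leqnSn /= [F _ + _]addrC addrK -big_mkcondr /=.
by apply: eq_bigl => z; rewrite antitree_adjE.
Qed.

Lemma near_sum_root (R : realType) n (F : nat -> R) : (2 <= n)%N ->
  \sum_(1 <= k < n.+1 | near_generation 1 k) F k = F 1%N + F 2%N.
Proof.
move=> n2; rewrite big_mkcond /= 2?big_ltn ?ltnS//; last exact: ltnW.
rewrite big_nat_cond big1 ?addr0// => k /andP[/andP[k3 _] _].
by rewrite /near_generation [(k <= 2)%N]leqNgt k3 andbF.
Qed.

Lemma near_sum (R : realType) m n (F : nat -> R) : (m.+3 <= n)%N ->
  \sum_(1 <= k < n.+1 | near_generation m.+2 k) F k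
    = F m.+1 + F m.+2 + F m.+3.
Proof.
move=> mn; rewrite big_mkcond /= (big_cat_nat (n := m.+1)) //=; last by lia.
rewrite big_nat_cond big1 ?add0r; last first.
  by move=> k /andP[/andP[_ km] _]; rewrite /near_generation ifF//; lia.
rewrite 3?big_ltn; [|lia..].
rewrite [X in _ + (_ + (_ + X))]big_nat_cond big1 ?addr0; last first.
  by move=> k /andP[/andP[km _] _]; rewrite /near_generation ifF//; lia.
rewrite addrA /near_generation !ifT//; lia.
Qed.

Lemma antitree_degE (R : realType) n (x : V) : (generation x < n)%N ->
  (graph_deg adj x)%:R
    = \sum_(1 <= k < n.+1 | near_generation (generation x) k) (a k)%:R - 1 :> R.
Proof.
move=> xn; rewrite (@graph_degE _ _ _ (first_generations a n)).
- rewrite -sum1_count natr_sum (antitree_nbr_sum (fun=> 1) (ltnW xn)).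
  by congr (_ - _); apply: eq_bigr => k _; rewrite mul1r.
- exact: first_generations_uniq.
- move=> z; rewrite antitree_adjE mem_first_generations => /and3P[_ _ zx].
  exact: leq_trans zx xn.
Qed.

Lemma antitree_lazy_walk_sum (R : realType) n (p : R) (x : V) (F : nat -> R) :
  (generation x <= n)%N ->
  \sum_(z <- first_generations a n) F (generation z) * lazy_walk adj p x z
    = p * F (generation x) + (1 - p) / (graph_deg adj x)%:R
      * (\sum_(1 <= k < n.+1 | near_generation (generation x) k) F k * (a k)%:R
         - F (generation x)).
Proof.
move=> xn; rewrite lazy_walk_sum ?antitree_adj_irr ?mem_first_generations//.
  by rewrite antitree_nbr_sum.
exact: first_generations_uniq.
Qed.

Lemma antitree_lazy_walk_mass (R : realType) n (p : R) (x : V) :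
  (generation x < n)%N -> (0 < graph_deg adj x)%N ->
  \sum_(z <- first_generations a n) lazy_walk adj p x z = 1.
Proof.
move=> xn deg_gt0; have deg_neq0 : (graph_deg adj x)%:R != 0 :> R.
  by rewrite pnatr_eq0 -lt0n.
under eq_bigr do rewrite -[lazy_walk _ _ _ _]mul1r.
rewrite (antitree_lazy_walk_sum p (fun=> 1) (ltnW xn)).
under eq_bigr do rewrite mul1r.
by rewrite -antitree_degE// divfK// mulr1 addrC subrK.
Qed.

Lemma antitree_lazy_walk_out (R : realType) n (p : R) (x z : V) :
  (generation x < n)%N -> z \notin first_generations a n ->
  lazy_walk adj p x z = 0.
Proof.
rewrite mem_first_generations -ltnNge antitree_lazy_walkE => xn nz.
rewrite ifN; last by apply: contraTneq nz => ->; rewrite -leqNgt ltnW.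
rewrite ifN// negb_and -!ltnNge; lia.
Qed.

Lemma antitree_radial_path (d : nat) (u v : V) :
  (forall k : nat, (1 <= k)%N -> (0 < a k)%N) ->
  generation v = (generation u + d.+1)%N ->
  exists s, [/\ path adj u s, last u s = v & size s = d.+1].
Proof.
move=> a_pos; elim: d u => [|d IHd] u uv.
  exists [:: v]; split=> //=; rewrite andbT antitree_adjE /near_generation uv.
  by apply/and3P; split; [apply/eqP => vu; move: uv; rewrite vu|..]; lia.
have /(a_pos _) w_pos : (1 <= (generation u).+1)%N by [].
pose w : V := Tagged (fun k => 'I_(a k.+1)) (Ordinal w_pos).
have wE : generation w = (generation u).+1 by [].
have [|s [ws lasts sizes]] := IHd w; first by rewrite wE uv; lia.
exists (w :: s); split=> //=; last by rewrite sizes.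
rewrite ws andbT antitree_adjE wE /near_generation.
by apply/and3P; split; [apply/eqP => wu; move: wE; rewrite wu|..]; lia.
Qed.

Lemma generation_lipschitz (R : realType) :
  lipschitz1 adj (fun z => (generation z)%:R : R).
Proof.
move=> u v; rewrite antitree_adjE => /and3P[_ _ vu].
by rewrite lerBlDr addrC natr1 ler_nat.
Qed.

(** A path that climbs one generation at each step exists because no generation
    is empty and consecutive ones are completely joined. *)
Lemma generation_tight (R : realType) (u v : V) :
  (forall k : nat, (1 <= k)%N -> (0 < a k)%N) ->
  (generation u < generation v)%N ->
  tight adj (fun z => (generation z)%:R : R) u v.
Proof.
move=> a_pos uv.
have [|s [us lasts sizes]] := @antitree_radial_path (generation v - generation u).-1 u v a_pos.
  by lia.
apply: (graph_dist_tight (s := s)) => //; first exact: generation_lipschitz.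
by rewrite sizes prednK ?subn_gt0// natrB// ltnW.
Qed.

Lemma generation1_unique (x z : V) : a 1 = 1%N ->
  generation x = 1%N -> generation z = 1%N -> z = x.
Proof.
move=> a1; case: x z => [k i] [l j] [/= k0] [/= l0]; subst k l.
congr existT; apply: val_inj => /=.
have lt1 (k : 'I_(a 1)) : (k < 1)%N by rewrite -{2}a1.
by move: (lt1 i) (lt1 j); rewrite !ltnS !leqn0 => /eqP -> /eqP ->.
Qed.

End Antitree.

(** * Curvature of the three kinds of edges *)

Section AntitreeCurvature.
Variables (R : realType) (a : nat -> nat).
Hypothesis a_pos : forall k : nat, (1 <= k)%N -> (0 < a k)%N.
Local Notation V := (antitree_vertex a).
Local Notation adj := (@antitree_adj a).
Local Notation deg x := ((graph_deg adj x)%:R : R).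

Lemma antitree_deg_root (x : V) :
  generation x = 1%N -> deg x = (a 1)%:R + (a 2)%:R - 1.
Proof. by move=> x1; rewrite (antitree_degE _ (n := 2)) x1// near_sum_root. Qed.

Lemma antitree_deg m (x : V) : generation x = m.+2 ->
  deg x = (a m.+1)%:R + (a m.+2)%:R + (a m.+3)%:R - 1.
Proof. by move=> xm; rewrite (antitree_degE _ (n := m.+3)) xm// near_sum. Qed.

Lemma a_ge1 k : (1 <= k)%N -> 1 <= (a k)%:R :> R.
Proof. by move=> /a_pos; rewrite ler1n. Qed.

Lemma antitree_deg_gt0 (x : V) : (0 < graph_deg adj x)%N.
Proof.
rewrite -(ltr_nat R); have x1 : (1 <= generation x)%N by [].
case xg: (generation x) x1 => [//|[|m]] _.
  rewrite antitree_deg_root//; have := a_ge1 (isT : (1 <= 1)%N).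
  by have := a_ge1 (isT : (1 <= 2)%N); lra.
rewrite (antitree_deg xg); have := a_ge1 (isT : (1 <= m.+1)%N).
have := a_ge1 (isT : (1 <= m.+2)%N); have := a_ge1 (isT : (1 <= m.+3)%N); lra.
Qed.

Lemma antitree_curvature_plan n (p : R) (x y : V) (F : nat -> R) :
  lipschitz1 adj (F \o @generation a) -> (generation x < n)%N ->
  finite_plan (first_generations a n) (tight adj (F \o @generation a))
    (lazy_walk adj p x) (lazy_walk adj p y) ->
  ollivier_curvature adj p x y
  = (1 - (\sum_(z <- first_generations a n) F (generation z) * lazy_walk adj p y z
        - \sum_(z <- first_generations a n) F (generation z) * lazy_walk adj p x z))%:E.
Proof.
move=> lip xn plan; rewrite /ollivier_curvature.
rewrite (wasserstein1_tight_plan (first_generations_uniq a n) lip _ plan) ?EFinB//.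
by rewrite antitree_lazy_walk_mass// antitree_deg_gt0.
Qed.

(** The direction in which mass crosses the edge depends on the sign of
    p - (1 - p) / deg x, hence the absolute value. *)
Lemma spherical_curvature (p : R) (x y : V) : 0 <= p <= 1 ->
  generation x = generation y -> x != y ->
  ollivier_curvature adj p x y = (1 - `|p - (1 - p) / deg x|)%:E.
Proof.
move=> p01 xy_gen xNy.
have deg_eq : deg y = deg x.
  by rewrite (antitree_degE _ (ltnSn _)) [RHS](antitree_degE _ (ltnSn _)) xy_gen.
have near_refl k : near_generation k k by rewrite /near_generation leqnSn.
have xy : adj x y by rewrite antitree_adjE eq_sym xNy xy_gen near_refl.
set n := (generation x).+1; set s := first_generations a n.
have xn : (generation x < n)%N by [].
have yn : (generation y < n)%N by rewrite -xy_gen.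
have agree z : z != x -> z != y -> lazy_walk adj p x z = lazy_walk adj p y z.
  move=> /negbTE zx /negbTE zy.
  by rewrite !antitree_lazy_walkE zx zy xy_gen deg_eq.
have lazyE : [/\ lazy_walk adj p x x = p, lazy_walk adj p y y = p,
    lazy_walk adj p x y = (1 - p) / deg x & lazy_walk adj p y x = (1 - p) / deg x].
  rewrite !antitree_lazy_walkE !eqxx (negbTE xNy) eq_sym (negbTE xNy).
  by rewrite xy_gen near_refl deg_eq.
have [xx yy lxy lyx] := lazyE.
have s_uniq : uniq s := first_generations_uniq a n.
have move_mass u v : u != v -> adj u v -> v \in s ->
    (forall z, z != u -> z != v -> lazy_walk adj p x z = lazy_walk adj p y z) ->
    lazy_walk adj p x v <= lazy_walk adj p y v ->
    wasserstein1 adj (lazy_walk adj p x) (lazy_walk adj p y)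
      = (lazy_walk adj p y v - lazy_walk adj p x v)%:E.
  move=> uNv uv vs agree_uv le_v; apply: (wasserstein1_edge s_uniq) uv _ le_v => //.
  - by move=> z; exact: lazy_walk_ge0.
  - by move=> z; exact: lazy_walk_ge0.
  - by move=> z; exact: antitree_lazy_walk_out.
  - by move=> z; exact: antitree_lazy_walk_out.
  - by rewrite antitree_lazy_walk_mass// antitree_deg_gt0.
  - by rewrite antitree_lazy_walk_mass// antitree_deg_gt0.
have yx : adj y x by rewrite antitree_adj_sym.
have xs : x \in s by rewrite mem_first_generations ltnW.
have ys : y \in s by rewrite mem_first_generations ltnW.
rewrite /ollivier_curvature; have [le_p | lt_p] := lerP ((1 - p) / deg x) p.
  by rewrite (move_mass x y) ?lxy ?yy// EFinB.
have -> : wasserstein1 adj (lazy_walk adj p x) (lazy_walk adj p y)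
    = (lazy_walk adj p y x - lazy_walk adj p x x)%:E.
  apply: move_mass yx xs _ _; first by rewrite eq_sym.
    by move=> z zy zx; rewrite agree.
  by rewrite lyx xx ltW.
by rewrite lyx xx EFinB.
Qed.

(** For p = 1 the walks are point masses, and x to y is itself a tight pair; so a
    plan that climbs the generations at one value of p yields one at every larger
    value. *)
Lemma antitree_plan_mix1 n (t p : R) (x y : V) :
  0 <= t <= 1 -> (generation x < generation y)%N -> (generation y < n)%N ->
  finite_plan (first_generations a n)
    (tight adj (fun z => (generation z)%:R : R)) (lazy_walk adj p x) (lazy_walk adj p y) ->
  finite_plan (first_generations a n) (tight adj (fun z => (generation z)%:R : R))
    (lazy_walk adj (t * p + (1 - t) * 1) x) (lazy_walk adj (t * p + (1 - t) * 1) y).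
Proof.
move=> /andP[t0 t1] xy yn plan.
have dirac_plan : finite_plan (first_generations a n)
    (tight adj (fun z => (generation z)%:R : R)) (dirac_mass R x) (dirac_mass R y).
  apply: finite_plan_dirac; rewrite ?first_generations_uniq//.
  - by rewrite mem_first_generations; lia.
  - by rewrite mem_first_generations; lia.
  - exact: generation_tight.
have t1' : 0 <= 1 - t by rewrite subr_ge0.
apply: (finite_plan_mix t0 t1' plan dirac_plan).
  by move=> z; rewrite lazy_walk_mix lazy_walk1.
by move=> z; rewrite lazy_walk_mix lazy_walk1.
Qed.

(** At p = 0 the vertex x is in deficit while the rest of its generation may be
    in excess, and a move inside a generation is not tight; so excess and deficit
    cannot be matched at once. After a vertex w of the generation below has
    filled this deficit of 1 / deg y, all remaining deficits lie in the top
    generation. *)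
Lemma radial_plan0 m (x y : V) :
  generation x = m.+2 -> generation y = m.+3 -> (a m.+1 <= a m.+4)%N ->
  finite_plan (first_generations a m.+4) (tight adj (fun z => (generation z)%:R : R))
    (lazy_walk adj (0 : R) x) (lazy_walk adj (0 : R) y).
Proof.
move=> xg yg a_le; set s := first_generations a m.+4.
have m1_pos : (0 < a m.+1)%N by exact: a_pos.
pose w : V := Tagged (fun k => 'I_(a k.+1)) (Ordinal m1_pos).
have wg : generation w = m.+1 by [].
have s_uniq : uniq s := first_generations_uniq a _.
have wx : w != x by apply/eqP => wx; move: wg; rewrite wx xg; lia.
have xy : x != y by apply/eqP => xy; move: xg; rewrite xy yg; lia.
have wy : w != y by apply/eqP => wy; move: wg; rewrite wy yg; lia.
have ws : w \in s by rewrite mem_first_generations wg; lia.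
have xs : x \in s by rewrite mem_first_generations xg; lia.
have yn : (generation y < m.+4)%N by rewrite yg.
have xn : (generation x < m.+4)%N by rewrite xg.
have dx_gt0 : 0 < deg x by rewrite ltr0n antitree_deg_gt0.
have dy_gt0 : 0 < deg y by rewrite ltr0n antitree_deg_gt0.
have d_le : deg x <= deg y.
  rewrite (antitree_deg xg) (antitree_deg yg).
  have := a_le; rewrite -(ler_nat R); lra.
pose al := (deg x)^-1; pose be := (deg y)^-1.
have be_ge0 : 0 <= be by rewrite invr_ge0 ltW.
have be_al : be <= al by rewrite lef_pV2 ?posrE.
have al_ge0 : 0 <= al by exact: le_trans be_al.
have lxE z : lazy_walk adj (0 : R) x z =
    if z == x then 0 else if near_generation m.+2 (generation z) then al else 0.
  by rewrite antitree_lazy_walkE xg subr0 mul1r.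
have lyE z : lazy_walk adj (0 : R) y z =
    if z == y then 0 else if near_generation m.+3 (generation z) then be else 0.
  by rewrite antitree_lazy_walkE yg subr0 mul1r.
pose mu z := lazy_walk adj (0 : R) x z - be * dirac_mass R w z.
pose nu z := lazy_walk adj (0 : R) y z - be * dirac_mass R x z.
have near_wx : near_generation m.+2 m.+1 by rewrite /near_generation; clear; lia.
have near_xy : near_generation m.+3 m.+2 by rewrite /near_generation; clear; lia.
have dirac_plan : finite_plan s (tight adj (fun z => (generation z)%:R : R))
    (dirac_mass R w) (dirac_mass R x).
  by apply: finite_plan_dirac => //; apply: generation_tight; rewrite // wg xg.
have rest_plan : finite_plan s (tight adj (fun z => (generation z)%:R : R)) mu nu.
  apply: finite_plan_excess_deficit => //.
  - move=> z; rewrite /mu /dirac_mass; case: eqVneq => [->|_]; last first.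
      by rewrite mulr0 subr0 lazy_walk_ge0// lexx ler01.
    by rewrite lxE (negbTE wx) wg near_wx mulr1 subr_ge0.
  - move=> z; rewrite /nu /dirac_mass; case: eqVneq => [->|_]; last first.
      by rewrite mulr0 subr0 lazy_walk_ge0// lexx ler01.
    by rewrite lyE (negbTE xy) xg near_xy mulr1 subr_ge0.
  - move=> z zs; rewrite /mu (antitree_lazy_walk_out _ xn zs) /dirac_mass.
    by case: eqVneq zs => [->|]; rewrite ?ws// mulr0 subr0.
  - move=> z zs; rewrite /nu (antitree_lazy_walk_out _ yn zs) /dirac_mass.
    by case: eqVneq zs => [->|]; rewrite ?xs// mulr0 subr0.
  - rewrite !sumrB (sum_dirac_mass (fun=> be))// (sum_dirac_mass (fun=> be))//.
    by rewrite !antitree_lazy_walk_mass// antitree_deg_gt0.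
  - exact: tight_refl.
  move=> u v exu dev; apply: generation_tight => //.
  have ug : (generation u <= m.+3)%N.
    rewrite leqNgt; apply/negP => ug; move: exu; apply/negP; rewrite -leNgt.
    have ux : u != x by apply/eqP => ux; move: ug; rewrite ux xg; clear; lia.
    have uw : u != w by apply/eqP => uw; move: ug; rewrite uw wg; clear; lia.
    rewrite /mu /nu /dirac_mass (negbTE ux) (negbTE uw) !mulr0 !subr0.
    rewrite lxE (negbTE ux) ifF ?lazy_walk_ge0 ?lexx ?ler01//.
    by move: ug; rewrite /near_generation; clear; lia.
  suff -> : generation v = m.+4 by [].
  apply/eqP; apply: contraTT dev => vg; rewrite -leNgt /mu /nu /dirac_mass.
  rewrite lxE lyE.
  have [-> | vx] := eqVneq v x.
    by rewrite (negbTE xy) eq_sym (negbTE wx) xg near_xy mulr1 subrr mulr0 subr0.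
  have [-> | vy] := eqVneq v y.
    rewrite eq_sym (negbTE wy) !mulr0 !subr0 yg.
    by case: ifP.
  have [-> | vw] := eqVneq v w.
    rewrite wg near_wx mulr0 mulr1 subr0 ifF ?subr_ge0//.
    by rewrite /near_generation; clear; lia.
  rewrite !mulr0 !subr0; case: ifP => [near_y | _]; last by case: ifP.
  rewrite ifT//; move: near_y vg; rewrite /near_generation; clear; lia.
apply: (finite_plan_mix be_ge0 ler01 dirac_plan rest_plan) => z.
  by rewrite mul1r /mu addrC subrK.
by rewrite mul1r /nu addrC subrK.
Qed.

Lemma radial_curvature m (p : R) (x y : V) :
  0 <= p <= 1 -> generation x = m.+2 -> generation y = m.+3 ->
  (a m.+1 <= a m.+4)%N ->
  ollivier_curvature adj p x y =
  (((2 * (a m.+2)%:R + (a m.+3)%:R - 1)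
      / ((a m.+2)%:R + (a m.+3)%:R + (a m.+4)%:R - 1)
    - (2 * (a m.+1)%:R + (a m.+2)%:R - 1)
      / ((a m.+1)%:R + (a m.+2)%:R + (a m.+3)%:R - 1)) * (1 - p))%:E.
Proof.
move=> p01 xg yg a_le; have plan0 := radial_plan0 xg yg a_le.
have plan : finite_plan (first_generations a m.+4)
    (tight adj (fun z => (generation z)%:R : R)) (lazy_walk adj p x) (lazy_walk adj p y).
  have := @antitree_plan_mix1 m.+4 (1 - p) 0 x y _ _ _ plan0.
  rewrite mulr0 add0r mulr1 subKr xg yg; apply=> //.
  by case/andP: p01 => p0 p1; rewrite subr_ge0 p1 gerBl.
have lip := @generation_lipschitz a R.
have xn : (generation x < m.+4)%N by rewrite xg ltnW.
rewrite (@antitree_curvature_plan _ _ _ _ (fun k => k%:R) lip xn plan).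
have dx_gt0 : 0 < deg x by rewrite ltr0n antitree_deg_gt0.
have dy_gt0 : 0 < deg y by rewrite ltr0n antitree_deg_gt0.
rewrite (antitree_deg xg) in dx_gt0; rewrite (antitree_deg yg) in dy_gt0.
congr EFin; do 2 rewrite (antitree_lazy_walk_sum p (fun k => k%:R)) ?xg ?yg 1?ltnW//.
rewrite (antitree_deg xg) (antitree_deg yg) !near_sum//.
field; lra.
Qed.

(** Up to the threshold p = (1 - p) / deg y, all excess lies in V_2 and all
    deficit in V_3 or at the root; the deficit at the root disappears at the
    threshold itself. *)
Lemma root_excess_deficit (p : R) (x y : V) : a 1 = 1%N -> 0 <= p <= 1 ->
  generation x = 1%N -> generation y = 2%N -> p <= (1 - p) / deg y ->
  (forall u, lazy_walk adj p y u < lazy_walk adj p x u -> generation u = 2%N) /\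
  (forall v, lazy_walk adj p x v < lazy_walk adj p y v ->
     generation v = 3%N \/ v = x /\ p < (1 - p) / deg y).
Proof.
move=> a1 p01 xg yg p_le.
have dx_gt0 : 0 < deg x by rewrite ltr0n antitree_deg_gt0.
have dy_gt0 : 0 < deg y by rewrite ltr0n antitree_deg_gt0.
have [p0 p1] := andP p01.
have p_mono : (1 - p) / deg y <= (1 - p) / deg x.
  rewrite ler_wpM2l ?subr_ge0// lef_pV2 ?posrE//.
  rewrite (antitree_deg_root xg) (antitree_deg yg); have := a_ge1 (isT : (1 <= 3)%N).
  lra.
have py_ge0 : 0 <= (1 - p) / deg y by rewrite (le_trans p0).
have xy : x != y by apply/eqP => xy; move: xg; rewrite xy yg.
split=> [u | v]; rewrite !antitree_lazy_walkE xg yg.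
  apply: contraPP => ug; apply/negP; rewrite -leNgt.
  have [-> | ux] := eqVneq u x; first by rewrite (negbTE xy) xg /=.
  have [uy | uy] := eqVneq u y; first by rewrite uy yg in ug.
  suff -> : near_generation 1 (generation u) = false by case: ifP.
  apply/negP => /andP[_ u2]; apply: (negP ux); apply/eqP/generation1_unique => //.
  by have : (1 <= generation u)%N by []; move: u2 ug; clear; lia.
have [-> | vx] := eqVneq v x; first by rewrite (negbTE xy) xg /=; right.
have [-> | vy] := eqVneq v y.
  by rewrite yg /= ltNge (le_trans p_le).
have v1 : (generation v != 1)%N.
  by apply: contraNneq vx => v1; apply/eqP/generation1_unique.
case: ifP => near_x; case: ifP => near_y; rewrite ?ltxx//.
- by rewrite ltNge p_mono.
- by rewrite ltNge (le_trans py_ge0).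
move=> _; left; have : (1 <= generation v)%N by [].
move: near_x near_y v1; rewrite /near_generation; clear; lia.
Qed.

Lemma root_curvature_small (p : R) (x y : V) : a 1 = 1%N -> 0 <= p <= 1 ->
  generation x = 1%N -> generation y = 2%N -> p <= (1 - p) / deg y ->
  ollivier_curvature adj p x y =
       (((a 2%N)%:R - 1) / ((a 2%N)%:R + (a 3%N)%:R)
        + ((a 2%N)%:R + 2 * (a 3%N)%:R + 1) / ((a 2%N)%:R + (a 3%N)%:R) * p)%:E.
Proof.
move=> a1 p01 xg yg p_le; pose F (k : nat) : R := (k != 2%N)%:R.
have F1 : F 1%N = 1 by [].
have F2 : F 2%N = 0 by [].
have F3 : F 3%N = 1 by [].
have [excess deficit] := root_excess_deficit a1 p01 xg yg p_le.
have lip := @indicator_lipschitz R V adj (fun z => generation z != 2%N).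
have xn : (generation x < 3)%N by rewrite xg.
have yn : (generation y < 3)%N by rewrite yg.
rewrite (@antitree_curvature_plan 3 _ _ _ F)//; last first.
  apply: finite_plan_excess_deficit.
  - exact: first_generations_uniq.
  - by move=> z; exact: lazy_walk_ge0.
  - by move=> z; exact: lazy_walk_ge0.
  - by move=> z; exact: antitree_lazy_walk_out.
  - by move=> z; exact: antitree_lazy_walk_out.
  - by rewrite !antitree_lazy_walk_mass// antitree_deg_gt0.
  - exact: tight_refl.
  move=> u v /excess ug /deficit vg.
  have {}vg : generation v = 3%N \/ generation v = 1%N.
    by case: vg => [-> | [-> _]]; [left | right].
  have uv : v != u by apply/eqP => uv; move: vg; rewrite uv ug; clear; lia.
  apply: tight_edge => //; last by rewrite /F /= ug; case: vg => -> /=; rewrite subr0.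
  by rewrite antitree_adjE uv ug; case: vg => ->.
have dx_gt0 : 0 < deg x by rewrite ltr0n antitree_deg_gt0.
have dy_gt0 : 0 < deg y by rewrite ltr0n antitree_deg_gt0.
rewrite (antitree_deg_root xg) a1 in dx_gt0; rewrite (antitree_deg yg) a1 in dy_gt0.
congr EFin; do 2 rewrite (antitree_lazy_walk_sum p F) ?xg ?yg//.
rewrite (antitree_deg_root xg) (antitree_deg yg) near_sum// near_sum_root// F1 F2 F3 a1.
clear -dx_gt0 dy_gt0; field; lra.
Qed.

Lemma root_curvature_large (p : R) (x y : V) : a 1 = 1%N -> 0 <= p <= 1 ->
  generation x = 1%N -> generation y = 2%N -> (1 - p) / deg y <= p ->
  ollivier_curvature adj p x y =
       (((a 2%N)%:R + 1) / ((a 2%N)%:R + (a 3%N)%:R) * (1 - p))%:E.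
Proof.
move=> a1 p01 xg yg p_ge; have [p0 p1] := andP p01.
have dx_gt0 : 0 < deg x by rewrite ltr0n antitree_deg_gt0.
have dy_gt0 : 0 < deg y by rewrite ltr0n antitree_deg_gt0.
have xn : (generation x < 3)%N by rewrite xg.
have yn : (generation y < 3)%N by rewrite yg.
(* q is the threshold, where q = (1 - q) / deg y. *)
pose q := (deg y + 1)^-1.
have q_eq : q = (1 - q) / deg y by rewrite /q; clear -dy_gt0; field; lra.
have q01 : 0 <= q <= 1.
  have dy1_gt0 : 0 < deg y + 1 by rewrite addr_gt0.
  by rewrite /q invr_ge0 (ltW dy1_gt0)/= invf_le1// lerDr ltW.
have q_le : q <= (1 - q) / deg y by rewrite -q_eq.
have [excess deficit] := root_excess_deficit a1 q01 xg yg q_le.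
have plan_q : finite_plan (first_generations a 3)
    (tight adj (fun z => (generation z)%:R : R)) (lazy_walk adj q x) (lazy_walk adj q y).
  apply: finite_plan_excess_deficit.
  - exact: first_generations_uniq.
  - by move=> z; exact: lazy_walk_ge0.
  - by move=> z; exact: lazy_walk_ge0.
  - by move=> z; exact: antitree_lazy_walk_out.
  - by move=> z; exact: antitree_lazy_walk_out.
  - by rewrite !antitree_lazy_walk_mass// antitree_deg_gt0.
  - exact: tight_refl.
  move=> u v /excess ug /deficit[vg | [_]]; last by rewrite -q_eq ltxx.
  by apply: generation_tight; rewrite // ug vg.
(* t solves p = t * q + (1 - t), and t <= 1 says that p is at least q. *)
pose t := (1 - p) * (deg y + 1) / deg y.
have t01 : 0 <= t <= 1.
  move: p_ge; rewrite /t ler_pdivrMr// => p_ge.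
  apply/andP; split; last by rewrite ler_pdivrMr//; clear -p_ge; lra.
  by apply: divr_ge0; [apply: mulr_ge0|]; clear -p1 dy_gt0; lra.
have pE : p = t * q + (1 - t) * 1 by rewrite /t /q; clear -dy_gt0; field; lra.
have plan : finite_plan (first_generations a 3)
    (tight adj (fun z => (generation z)%:R : R)) (lazy_walk adj p x) (lazy_walk adj p y).
  by rewrite pE; apply: antitree_plan_mix1; rewrite ?xg ?yg.
have lip := @generation_lipschitz a R.
rewrite (@antitree_curvature_plan _ _ _ _ (fun k => k%:R) lip xn plan).
rewrite (antitree_deg_root xg) a1 in dx_gt0; rewrite (antitree_deg yg) a1 in dy_gt0.
congr EFin; do 2 rewrite (antitree_lazy_walk_sum p (fun k => k%:R)) ?xg ?yg//.
rewrite (antitree_deg_root xg) (antitree_deg yg) near_sum// near_sum_root// a1.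
clear -dx_gt0 dy_gt0; field; lra.
Qed.

End AntitreeCurvature.

Theorem theorem1p6 (R : realType) (a : nat -> nat)
  (a_pos : forall k : nat, (1 <= k)%N -> (0 < a k)%N)
  (a1 : a 1%N = 1%N)
  (a_mono : forall k : nat, (1 <= k)%N -> (a k <= a k.+1)%N)
  (x y : antitree_vertex a) (xy : antitree_adj x y)
  (p : R) (p01 : 0 <= p <= 1) :
  [/\ (* radial root edges *)
      generation x = 1%N -> generation y = 2%N ->
      (0 <= p <= 1 / ((a 2%N)%:R + (a 3%N)%:R + 1) ->
       ollivier_curvature (@antitree_adj a) p x y =
       (((a 2%N)%:R - 1) / ((a 2%N)%:R + (a 3%N)%:R)
        + ((a 2%N)%:R + 2 * (a 3%N)%:R + 1) / ((a 2%N)%:R + (a 3%N)%:R) * p)%:E) /\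
      (1 / ((a 2%N)%:R + (a 3%N)%:R + 1) <= p <= 1 ->
       ollivier_curvature (@antitree_adj a) p x y =
       (((a 2%N)%:R + 1) / ((a 2%N)%:R + (a 3%N)%:R) * (1 - p))%:E),
      (* radial edges *)
      forall k : nat, (2 <= k)%N -> generation x = k -> generation y = k.+1 ->
      ollivier_curvature (@antitree_adj a) p x y =
      (((2 * (a k)%:R + (a k.+1)%:R - 1)
          / ((a k)%:R + (a k.+1)%:R + (a k.+2)%:R - 1)
        - (2 * (a k.-1)%:R + (a k)%:R - 1)
          / ((a k.-1)%:R + (a k)%:R + (a k.+1)%:R - 1)) * (1 - p))%:E
    & (* spherical edges *)
      forall k : nat, (2 <= k)%N -> generation x = k -> generation y = k -> x <> y ->
      (0 <= p <= 1 / ((a k.-1)%:R + (a k)%:R + (a k.+1)%:R) ->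
       ollivier_curvature (@antitree_adj a) p x y =
       (((a k.-1)%:R + (a k)%:R + (a k.+1)%:R - 2)
          / ((a k.-1)%:R + (a k)%:R + (a k.+1)%:R - 1)
        + ((a k.-1)%:R + (a k)%:R + (a k.+1)%:R)
          / ((a k.-1)%:R + (a k)%:R + (a k.+1)%:R - 1) * p)%:E) /\
      (1 / ((a k.-1)%:R + (a k)%:R + (a k.+1)%:R) <= p <= 1 ->
       ollivier_curvature (@antitree_adj a) p x y =
       (((a k.-1)%:R + (a k)%:R + (a k.+1)%:R)
          / ((a k.-1)%:R + (a k)%:R + (a k.+1)%:R - 1) * (1 - p))%:E)].
Proof.
have [p0 p1] := andP p01.
have threshold (d : R) : 0 < d -> (p <= (1 - p) / d) = (p <= 1 / (d + 1)).
  move=> d_gt0; rewrite !ler_pdivlMr ?addr_gt0//.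
  by apply/idP/idP; lra.
have threshold' (d : R) : 0 < d -> ((1 - p) / d <= p) = (1 / (d + 1) <= p).
  move=> d_gt0; rewrite !ler_pdivrMr ?addr_gt0//.
  by apply/idP/idP; lra.
split.
- move=> xg yg; have dyE := antitree_deg R yg.
  have dy_gt0 : 0 < (graph_deg (@antitree_adj a) y)%:R :> R.
    by rewrite ltr0n antitree_deg_gt0.
  have {}dyE : (graph_deg (@antitree_adj a) y)%:R = (a 2)%:R + (a 3)%:R :> R.
    by rewrite dyE a1; ring.
  split=> /andP[p_ge p_le].
    by apply: root_curvature_small => //; rewrite threshold// dyE.
  by apply: root_curvature_large => //; rewrite threshold'// dyE.
- move=> [|[|m]]// _ xg yg; apply: radial_curvature => //.
  apply: leq_trans (a_mono m.+1 isT) _; apply: leq_trans (a_mono m.+2 isT) _.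
  exact: a_mono.
- move=> [|[|m]]// _ xg yg /eqP xNy /=.
  have dx_gt0 : 0 < (graph_deg (@antitree_adj a) x)%:R :> R.
    by rewrite ltr0n antitree_deg_gt0.
  rewrite spherical_curvature ?xg//.
  have dxE := antitree_deg R xg.
  have dx1 : (a m.+1)%:R + (a m.+2)%:R + (a m.+3)%:R
      = (graph_deg (@antitree_adj a) x)%:R + 1 :> R by rewrite dxE; ring.
  rewrite dx1; split=> /andP[p_ge p_le]; congr EFin.
    rewrite ler0_norm; last by rewrite subr_le0 threshold.
    by clear -dx_gt0; field; lra.
  rewrite ger0_norm; last by rewrite subr_ge0 threshold'.
  by clear -dx_gt0; field; lra.
Qed.
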